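(* Let $0<\beta<1$, $0\le\alpha\le1$, and let $\delta>2$ be an integer. The kernels $\mathcal{K}_{TC\delta}$ (with hyperparameter $\beta$) and $\mathcal{K}_{DC\delta}$ (with hyperparameters $\alpha,\beta$) are exponentially convex local stationary (ECLS); that is, there exist stationary kernels $\mathcal{W}_{TC\delta}$ and $\mathcal{W}_{DC\delta}$ such that, for all $t,s\ge1$, $$[\mathcal{K}_{TC\delta}]_{t,s}=\beta^{\frac{t+s}{2}}[\mathcal{W}_{TC\delta}]_{t,s},\qquad [\mathcal{K}_{DC\delta}]_{t,s}=\beta^{\frac{t+s}{2}}[\mathcal{W}_{DC\delta}]_{t,s}.$$
   Context: All infinite matrices are real and indexed by $t,s\ge1$; entries of their products are (convergent) series. $\mathcal{S}_\infty$ denotes the cone of positive definite symmetric infinite matrices (symmetric with every finite principal submatrix positive definite). A stationary kernel is a matrix $\mathcal{W}\in\mathcal{S}_\infty$ (the covariance function of a stationary process) with $[\mathcal{W}]_{t,s}=[\mathcal{W}]_{t+k,s+k}$ for all $k\in\mathbb{N}$ and all $t,s\ge 1$. Let $\mathcal{F}$ be the infinite lower triangular Toeplitz matrix with first column $(1,-1,0,0,\ldots)^\top$, $\mathcal{D}=\mathrm{diag}(\beta^{-1},\beta^{-2},\ldots,\beta^{-t},\ldots)$, and $\mathcal{F}_{\delta,\alpha}=(1-\alpha)\mathcal{F}^{\delta-1}+\alpha\mathcal{F}^{\delta}$. The TC$\delta$ and DC$\delta$ kernels are $$\mathcal{K}_{TC\delta}=\kappa_\delta(\mathcal{F}^\delta\mathcal{D}(\mathcal{F}^\delta)^\top)^{-1},\qquad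 \mathcal{K}_{DC\delta}=\kappa_\delta(\mathcal{F}_{\delta,\alpha}\mathcal{D}\mathcal{F}_{\delta,\alpha}^\top)^{-1},$$ where in each case $\kappa_\delta>0$ is a normalization constant (not depending on $t,s$; the two constants need not coincide), and for a lower triangular Toeplitz $\mathcal{G}$ with nonzero diagonal, $(\mathcal{G}\mathcal{D}\mathcal{G}^\top)^{-1}$ is understood as $(\mathcal{G}^{-1})^\top\mathcal{D}^{-1}\mathcal{G}^{-1}$ with $\mathcal{G}^{-1}$ the lower triangular Toeplitz inverse of $\mathcal{G}$. *)

(* Defs.v *)
From mathcomp Require Import all_boot all_order all_algebra.
From mathcomp Require Import all_classical all_reals all_analysis.

Set Implicit Arguments.
Unset Strict Implicit.
Unset Printing Implicit Defensive.

Import Order.TTheory GRing.Theory Num.Theory.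
Import numFieldNormedType.Exports.

Local Open Scope classical_set_scope.
Local Open Scope ring_scope.

(* Indices are shifted by one: [A i j] is the entry in row t = i.+1 and
   column s = j.+1 of an infinite matrix indexed by t, s >= 1. *)
Definition infmx (R : Type) : Type := nat -> nat -> R.

Section InfiniteMatrices.
Variable R : realType.
Implicit Types A B G H : infmx R.

Definition infmx_tr A : infmx R := fun i j => A j i.

Definition infmx_diag (d : nat -> R) : infmx R :=
  fun i j => if i == j then d i else 0.

Definition infmx_one : infmx R := infmx_diag (fun=> 1).

(* [limn] returns a default value on divergent sequences, so a product is
   meaningful only together with [infmx_mul_cvg]. *)
Definition infmx_mul_cvg A B : Prop :=
  forall i j, cvgn (series (fun k => A i k * B k j)).

Definition infmx_mul A B : infmx R :=
  fun i j => limn (series (fun k => A i k * B k j)).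

Definition infmx_exp A (n : nat) : infmx R := iter n (infmx_mul A) infmx_one.

Definition lower_triangular A : Prop := forall i j, (i < j)%N -> A i j = 0.

Definition shift_invariant A : Prop :=
  forall k i j, A (i + k)%N (j + k)%N = A i j.

Definition ltoeplitz A : Prop := lower_triangular A /\ shift_invariant A.

Definition ltoeplitz_of (c : nat -> R) : infmx R :=
  fun i j => if (j <= i)%N then c (i - j)%N else 0.

Definition is_ltoeplitz_inv G H : Prop :=
  [/\ ltoeplitz H, infmx_mul G H = infmx_one & infmx_mul H G = infmx_one].

(* Meaningful when such an inverse exists; see [ltoeplitz_invP],
   [is_ltoeplitz_inv_TC] and [is_ltoeplitz_inv_DC]. *)
Definition ltoeplitz_inv G : infmx R :=
  xget (fun _ _ => 0) [set H | is_ltoeplitz_inv G H].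

Definition principal_submx A n (f : 'I_n -> nat) : 'M[R]_n :=
  \matrix_(i, j) A (f i) (f j).

Definition posdefmx n (M : 'M[R]_n) : Prop :=
  forall x : 'cV[R]_n, x != 0 -> 0 < (x^T *m M *m x) 0 0.

Definition infmx_posdef A : Prop :=
  (forall i j, A i j = A j i) /\
  forall n (f : 'I_n -> nat), {homo f : i j / (i < j)%N} ->
    posdefmx (principal_submx A f).

Definition stationary_kernel W : Prop := infmx_posdef W /\ shift_invariant W.

Definition ecls (beta : R) (K : infmx R) : Prop :=
  exists2 W : infmx R, stationary_kernel W &
    forall i j, K i j = beta `^ ((i.+1 + j.+1)%:R / 2) * W i j.

Definition Fmx : infmx R := ltoeplitz_of (fun n => [:: 1; -1]`_n).

Definition Fmx_mix (delta : nat) (alpha : R) : infmx R := fun i j =>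
  (1 - alpha) * infmx_exp Fmx delta.-1 i j + alpha * infmx_exp Fmx delta i j.

Definition Ddiag (beta : R) (i : nat) : R := beta ^- i.+1.

Definition Dinvmx (beta : R) : infmx R :=
  infmx_diag (fun i => (Ddiag beta i)^-1).

(* kappa (G D G^T)^-1, read as kappa (G^-1)^T D^-1 G^-1. *)
Definition filter_kernel (kappa beta : R) G : infmx R := fun i j =>
  kappa * infmx_mul (infmx_mul (infmx_tr (ltoeplitz_inv G)) (Dinvmx beta))
                    (ltoeplitz_inv G) i j.

(* The inner product with the diagonal matrix always converges, see
   [infmx_mul_cvg_diag]. *)
Definition filter_kernel_cvg (beta : R) G : Prop :=
  infmx_mul_cvg (infmx_mul (infmx_tr (ltoeplitz_inv G)) (Dinvmx beta))
                (ltoeplitz_inv G).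

Definition TC_kernel (kappa beta : R) (delta : nat) : infmx R :=
  filter_kernel kappa beta (infmx_exp Fmx delta).

Definition DC_kernel (kappa alpha beta : R) (delta : nat) : infmx R :=
  filter_kernel kappa beta (Fmx_mix delta alpha).

Lemma cvg_series_fin (u : nat -> R) (N : nat) :
  (forall k, (N <= k)%N -> u k = 0) ->
  series u @ \oo --> \sum_(0 <= k < N) u k.
Proof.
move=> u0; apply: cvg_near_cst; exists N => // n /= Nn.
rewrite /series /= (big_cat_nat (leq0n N) Nn) //= [X in _ + X]big_nat_cond.
by rewrite [X in _ + X]big1 ?addr0 // => k /andP[/andP[/u0]].
Qed.

Lemma infmx_mul_fin A B i j (N : nat) :
  (forall k, (N <= k)%N -> A i k * B k j = 0) ->
  infmx_mul A B i j = \sum_(0 <= k < N) A i k * B k j.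
Proof. by move=> /cvg_series_fin /cvg_lim; apply. Qed.

Lemma infmx_mul_cvg_ltri A B : lower_triangular A -> infmx_mul_cvg A B.
Proof.
move=> At i j; apply: cvgP; apply: (@cvg_series_fin _ i.+1) => k ik.
by rewrite At // mul0r.
Qed.

Lemma infmx_mul_cvg_diag A (d : nat -> R) : infmx_mul_cvg A (infmx_diag d).
Proof.
move=> i j; apply: cvgP; apply: (@cvg_series_fin _ j.+1) => k jk.
by rewrite /infmx_diag gtn_eqF // mulr0.
Qed.

Definition cauchy_conv (c d : nat -> R) (n : nat) : R :=
  \sum_(k < n.+1) c (n - k)%N * d k.

Lemma infmx_mul_ltoeplitz_of (c d : nat -> R) :
  infmx_mul (ltoeplitz_of c) (ltoeplitz_of d) =
  ltoeplitz_of (cauchy_conv c d).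
Proof.
apply/funext => i; apply/funext => j.
rewrite (@infmx_mul_fin _ _ _ _ i.+1); last first.
  by move=> k ik; rewrite /ltoeplitz_of leqNgt ik mul0r.
rewrite /ltoeplitz_of; case: leqP => [ji|ij]; last first.
  rewrite big_nat big1 // => k /andP[_ ki].
  by rewrite [(j <= k)%N]leqNgt (leq_trans ki ij) mulr0.
have jiS : (j <= i.+1)%N by rewrite leqW.
rewrite (big_cat_nat (leq0n j) jiS) //= big_nat big1 ?add0r; last first.
  by move=> k /andP[_ kj]; rewrite [(j <= k)%N]leqNgt kj mulr0.
rewrite -{1}[j]add0n big_addn subSn // big_mkord; apply: eq_bigr => k _.
have ki : (k + j <= i)%N by rewrite addnC -leq_subRL // -ltnS.
by rewrite ki leq_addl addnK subnDA [(i - k - j)%N]subnAC.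
Qed.

Lemma ltoeplitzE A : ltoeplitz A -> A = ltoeplitz_of (A ^~ 0%N).
Proof.
move=> [At As]; apply/funext => i; apply/funext => j.
rewrite /ltoeplitz_of; case: leqP => [ji|/At//].
by rewrite -(As j (i - j)%N 0%N) subnK // add0n.
Qed.

Lemma lt_toeplitz_of (c : nat -> R) : ltoeplitz (ltoeplitz_of c).
Proof.
split=> [i j ij|k i j]; first by rewrite /ltoeplitz_of leqNgt ij.
by rewrite /ltoeplitz_of leq_add2r subnDr.
Qed.

Lemma ltoeplitz_one : ltoeplitz_of (fun n => (n == 0%N)%:R) = infmx_one.
Proof.
apply/funext => i; apply/funext => j; rewrite /ltoeplitz_of /infmx_one.
by rewrite /infmx_diag subn_eq0; case: ltngtP.
Qed.

Lemma convC (c d : nat -> R) : cauchy_conv c d = cauchy_conv d c.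
Proof.
apply/funext => n; rewrite /cauchy_conv (reindex_inj rev_ord_inj) /=.
by apply: eq_bigr => k _; rewrite mulrC subSS subKn -1?ltnS.
Qed.

Lemma conv_inv (c : nat -> R) : c 0%N != 0 ->
  exists h : nat -> R, cauchy_conv c h = fun n => (n == 0%N)%:R.
Proof.
move=> c0; pose h1 s : R := (c 0%N)^-1 *
  ((size s == 0%N)%:R - \sum_(k < size s) c (size s - k)%N * s`_k).
pose hs := fix hs n : seq R := if n is m.+1 then rcons (hs m) (h1 (hs m)) else [::].
have szh n : size (hs n) = n by elim: n => //= n; rewrite size_rcons => ->.
have nthh n k : (k < n)%N -> (hs n)`_k = h1 (hs k).
  elim: n => // n IH; rewrite ltnS leq_eqVlt /= nth_rcons szh => /orP[/eqP->|kn].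
    by rewrite ltnn eqxx.
  by rewrite kn IH.
exists (fun n => h1 (hs n)); apply/funext => n; rewrite /cauchy_conv big_ord_recr /=.
rewrite subnn {2}/h1 mulrA divff // mul1r szh.
under [X in _ - X]eq_bigr => k _ do rewrite nthh //.
by rewrite addrC subrK.
Qed.

Lemma conv_inj (c h1 h2 : nat -> R) :
  c 0%N != 0 -> cauchy_conv c h1 = cauchy_conv c h2 -> h1 = h2.
Proof.
move=> c0 e; apply/funext => n; elim/ltn_ind: n => n IH.
have := congr1 (@^~ n) e; rewrite /cauchy_conv !big_ord_recr /= subnn.
under eq_bigr => k _ do rewrite IH //.
by move=> /addrI /(mulfI c0).
Qed.

Lemma ltoeplitz_invP G : ltoeplitz G -> G 0%N 0%N != 0 ->
  forall H, is_ltoeplitz_inv G H <-> H = ltoeplitz_inv G.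
Proof.
move=> Gt G0.
have uniq H1 H2 : is_ltoeplitz_inv G H1 -> is_ltoeplitz_inv G H2 -> H1 = H2.
  move=> [t1 + _] [t2 + _]; rewrite (ltoeplitzE Gt) (ltoeplitzE t1) (ltoeplitzE t2).
  rewrite !infmx_mul_ltoeplitz_of => <- e; congr ltoeplitz_of.
  apply: (@conv_inj (G ^~ 0%N) _ _ G0); apply/funext => n.
  by have := congr1 (fun A : infmx R => A n 0%N) (esym e); rewrite /ltoeplitz_of /= subn0.
have [h hP] := @conv_inv (G ^~ 0%N) G0.
have inv : is_ltoeplitz_inv G (ltoeplitz_inv G).
  suff ex : exists H, [set H | is_ltoeplitz_inv G H] H.
    exact: (xgetPex (fun _ _ => 0) ex).
  exists (ltoeplitz_of h); split; first exact: lt_toeplitz_of.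
    by rewrite (ltoeplitzE Gt) infmx_mul_ltoeplitz_of hP ltoeplitz_one.
  rewrite (ltoeplitzE Gt) infmx_mul_ltoeplitz_of -ltoeplitz_one.
  by congr ltoeplitz_of; rewrite convC.
by move=> H; split=> [/uniq|->]; [apply|].
Qed.

Lemma infmx_exp_F (n : nat) : exists2 c : nat -> R,
  c 0%N = 1 & infmx_exp Fmx n = ltoeplitz_of c.
Proof.
elim: n => [|n [c c0 IH]]; first by exists (fun n => (n == 0%N)%:R); rewrite ?ltoeplitz_one.
exists (cauchy_conv (fun n => [:: 1; -1]`_n) c).
  by rewrite /cauchy_conv big_ord1 /= c0 mulr1.
by rewrite /infmx_exp iterS -/(infmx_exp _ _) IH infmx_mul_ltoeplitz_of.
Qed.

Lemma is_ltoeplitz_inv_TC (delta : nat) :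
  is_ltoeplitz_inv (infmx_exp Fmx delta) (ltoeplitz_inv (infmx_exp Fmx delta)).
Proof.
have [c c0 ->] := infmx_exp_F delta.
apply/ltoeplitz_invP => //; first exact: lt_toeplitz_of.
by rewrite /ltoeplitz_of /= c0 oner_neq0.
Qed.

Lemma is_ltoeplitz_inv_DC (delta : nat) (alpha : R) :
  is_ltoeplitz_inv (Fmx_mix delta alpha) (ltoeplitz_inv (Fmx_mix delta alpha)).
Proof.
have [c c0 ec] := infmx_exp_F delta.-1; have [d d0 ed] := infmx_exp_F delta.
have -> : Fmx_mix delta alpha =
    ltoeplitz_of (fun n => (1 - alpha) * c n + alpha * d n).
  apply/funext => i; apply/funext => j; rewrite /Fmx_mix ec ed /ltoeplitz_of.
  by case: ifP => // _; rewrite !mulr0 addr0.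
apply/ltoeplitz_invP => //; first exact: lt_toeplitz_of.
by rewrite /ltoeplitz_of /= c0 d0 !mulr1 subrK oner_neq0.
Qed.

End InfiniteMatrices.

(* Main.v *)
Require Import Defs.
From mathcomp Require Import all_boot all_order all_algebra.
From mathcomp Require Import all_classical all_reals all_analysis.
From mathcomp Require Import ring lra.

(** A Toeplitz filter [G] with first column [c] has inverse [H] with first
    column [h], the convolution inverse of [c], so the kernel entries are
    [kappa * \sum_k H k i * H k j * beta ^+ k.+1].  Shifting [i], [j] and [k] by
    one multiplies every term by [beta], which makes the kernel divided by
    [beta `^ ((t + s) / 2)] shift invariant; positive definiteness holds because
    the quadratic form is a sum of squares, one of which is isolated by the
    triangular shape of [H].  Convergence follows from [h n = O(rho ^+ n)] for
    some [rho > 1] with [rho ^+ 2 * beta < 1]: both filters are finite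
    convolution products of sequences [(1, - a, 0, ...)] with [0 <= a <= 1], and
    convolving with the inverse [a ^+ n] of such a factor preserves that
    growth. *)

Set Implicit Arguments.
Unset Strict Implicit.

Import Order.TTheory GRing.Theory Num.Theory.
Import numFieldNormedType.Exports.
Local Open Scope classical_set_scope.
Local Open Scope ring_scope.

(** * Convolution inverses and their growth *)

Section Convolution.
Variable R : realType.
Implicit Types c d e h : nat -> R.

Definition conv_one : nat -> R := fun n => (n == 0%N)%:R.

Definition conv_linear_factor (a : R) : nat -> R := fun n => [:: 1; - a]`_n.

(* [cauchy_conv] is the coefficient formula of the polynomial product, so
   associativity is inherited from truncations. *)
Lemma cauchy_conv_assoc c d e :
  cauchy_conv (cauchy_conv c d) e = cauchy_conv c (cauchy_conv d e).
Proof.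
apply/funext => n.
pose P (u : nat -> R) : {poly R} := \poly_(i < n.+1) u i.
have PE u k : (k <= n)%N -> (P u)`_k = u k by move=> kn; rewrite coef_poly ltnS kn.
have convE u v k : (k <= n)%N -> cauchy_conv u v k = (P u * P v)`_k.
  move=> kn; rewrite coefMr; apply: eq_bigr => j _.
  by rewrite !PE ?(leq_trans (leq_subr _ _)) ?(leq_trans _ kn) // -ltnS.
have convP u v k : (k <= n)%N -> (P (cauchy_conv u v))`_k = (P u * P v)`_k.
  by move=> kn; rewrite PE // convE.
rewrite !convE // !coefM.
transitivity ((P c * P d * P e)`_n); first rewrite coefM.
  by apply: eq_bigr => j _; rewrite convP // -ltnS.
rewrite -mulrA coefM; apply: eq_bigr => j _.
by rewrite convP // leq_subr.
Qed.

Lemma cauchy_conv1 c : cauchy_conv c conv_one = c.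
Proof.
apply/funext => n; rewrite /cauchy_conv big_ord_recl subn0 mulr1 big1 ?addr0 //.
by move=> i _; rewrite /conv_one /= mulr0.
Qed.

Lemma cauchy_1conv c : cauchy_conv conv_one c = c.
Proof. by rewrite Defs.convC cauchy_conv1. Qed.

(** The geometric series: in generating functions, [1 / (1 - a z)] has coefficients [a ^+ n]. *)
Lemma conv_linear_factor_inv (a : R) :
  cauchy_conv (conv_linear_factor a) (fun n => a ^+ n) = conv_one.
Proof.
apply/funext => -[|n]; first by rewrite /cauchy_conv big_ord1 mulr1.
rewrite /cauchy_conv 2!big_ord_recr /= subnn subSnn /= big1 => [|i _].
  by rewrite /conv_linear_factor /conv_one /= exprS; ring.
rewrite /conv_linear_factor nth_default ?mul0r //=.
by rewrite ltn_subRL addn1 ltnS ltn_ord.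
Qed.

Definition exp_growth (rho : R) h : Prop :=
  exists C : R, forall n, `|h n| <= C * rho ^+ n.

Definition conv_inv_growth (rho : R) c : Prop :=
  exists2 h, cauchy_conv c h = conv_one & exp_growth rho h.

(** The geometric sum of [rho ^+ k] up to [n] is at most [rho ^+ n.+1 / (rho - 1)], so only the
    constant worsens, not the rate. Strictness of [1 < rho] absorbs the polynomial growth that
    repeated partial sums ([g = 1]) create. *)
Lemma exp_growth_conv (rho : R) h g : 1 < rho -> exp_growth rho h ->
  (forall n, `|g n| <= 1) -> exp_growth rho (cauchy_conv g h).
Proof.
move=> rho1 [C hC] g1.
have C0 : 0 <= C by have := hC 0%N; rewrite expr0 mulr1; apply: le_trans.
have r0 : 0 < rho - 1 by rewrite subr_gt0.
have geo n : (\sum_(k < n) rho ^+ k) <= rho ^+ n / (rho - 1).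
  rewrite ler_pdivlMr // mulrC -subrX1; lra.
exists (C * rho / (rho - 1)) => n; apply: le_trans (ler_norm_sum _ _ _) _.
apply: (@le_trans _ _ (\sum_(k < n.+1) C * rho ^+ k)).
  apply: ler_sum => k _; rewrite normrM -[leRHS]mul1r.
  exact: ler_pM.
rewrite -mulr_sumr; apply: le_trans (ler_wpM2l C0 (geo _)) _.
by rewrite exprS le_eqVlt; apply/orP; left; apply/eqP; ring.
Qed.

Lemma conv_inv_growth1 (rho : R) : 1 < rho -> conv_inv_growth rho conv_one.
Proof.
move=> rho1; exists conv_one; first exact: cauchy_conv1.
exists 1 => n; rewrite mul1r /conv_one; case: eqP => _.
  by rewrite normr1 exprn_ege1 // ltW.
by rewrite normr0 exprn_ge0 // (le_trans ler01) // ltW.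
Qed.

Lemma conv_inv_growth_linear_factor (rho a : R) c : 1 < rho -> 0 <= a <= 1 ->
  conv_inv_growth rho c ->
  conv_inv_growth rho (cauchy_conv (conv_linear_factor a) c).
Proof.
move=> rho1 /andP[a0 a1] [h ch hg].
exists (cauchy_conv (fun n => a ^+ n) h); last first.
  apply: exp_growth_conv => // n.
  by rewrite ger0_norm ?exprn_ge0 // exprn_ile1.
(* Reassociate so that [c] meets [h] and cancels, leaving the linear factor against its geometric
   inverse. *)
rewrite [cauchy_conv (fun n => _) h]Defs.convC cauchy_conv_assoc.
rewrite -[cauchy_conv c (cauchy_conv _ _)]cauchy_conv_assoc ch cauchy_1conv.
exact: conv_linear_factor_inv.
Qed.

Lemma infmx_exp_F_growth (rho : R) (n : nat) : 1 < rho ->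
  exists2 c, infmx_exp (Fmx R) n = ltoeplitz_of c & conv_inv_growth rho c.
Proof.
move=> rho1; elim: n => [|n [c ec cg]].
  by exists conv_one; [rewrite ltoeplitz_one|exact: conv_inv_growth1].
exists (cauchy_conv (conv_linear_factor 1) c).
  by rewrite /infmx_exp iterS -/(infmx_exp _ _) ec infmx_mul_ltoeplitz_of.
by apply: conv_inv_growth_linear_factor => //; rewrite ler01 lexx.
Qed.

(** The mixture factors as the [n]-th power of [Fmx] times one more linear factor, since [(1 -
    alpha) + alpha (1 - z) = 1 - alpha z]. *)
Lemma Fmx_mix_growth (rho alpha : R) (n : nat) : 1 < rho -> 0 <= alpha <= 1 ->
  exists2 c, Fmx_mix n.+1 alpha = ltoeplitz_of c & conv_inv_growth rho c.
Proof.
move=> rho1 a01; have [c ec cg] := infmx_exp_F_growth n rho1.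
exists (cauchy_conv (conv_linear_factor alpha) c); last first.
  exact: conv_inv_growth_linear_factor.
apply/funext => i; apply/funext => j; rewrite /Fmx_mix /= -/(infmx_exp _ _) ec.
rewrite infmx_mul_ltoeplitz_of /ltoeplitz_of.
case: ifP => _; last by rewrite !mulr0 addr0.
rewrite -[c in (1 - alpha) * c _]cauchy_1conv /cauchy_conv !mulr_sumr -big_split.
apply: eq_bigr => k _ /=; rewrite !mulrA -mulrDl; congr (_ * _).
rewrite /conv_one /conv_linear_factor.
by case: (i - j - k)%N => [|[|m]] /=; rewrite ?nth_nil; ring.
Qed.

End Convolution.

(** * The kernel series: convergence, shift covariance, positivity *)

Section FilterKernel.
Variables (R : realType) (beta rho : R) (h : nat -> R).
Hypotheses (beta_gt0 : 0 < beta) (rho_gt1 : 1 < rho).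
Hypotheses (rho_beta : rho ^+ 2 * beta < 1) (h_growth : exp_growth rho h).

Let H : infmx R := ltoeplitz_of h.

Definition filter_term i j k : R := H k i * H k j * beta ^+ k.+1.

Definition filter_gram : infmx R := fun i j => limn (series (filter_term i j)).

Lemma filter_product_term i j k :
  infmx_mul (infmx_tr H) (Dinvmx beta) i k * H k j = filter_term i j k.
Proof.
rewrite (@infmx_mul_fin _ _ _ _ _ k.+1) => [|l kl]; last first.
  by rewrite /Dinvmx /infmx_diag gtn_eqF // mulr0.
rewrite big_nat_recr //= big_nat big1 ?add0r => [|l /andP[_ lk]]; last first.
  by rewrite /Dinvmx /infmx_diag ltn_eqF // mulr0.
by rewrite /filter_term /Dinvmx /infmx_diag eqxx /Ddiag invrK /infmx_tr mulrAC.
Qed.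

Lemma filter_term_cvg i j : cvgn (series (filter_term i j)).
Proof.
have [C hC] := h_growth.
have C0 : 0 <= C by have := hC 0%N; rewrite expr0 mulr1; apply: le_trans.
have r0 : 0 <= rho by rewrite (le_trans ler01) // ltW.
(* A bound uniform in the column [l], because [k - l <= k] and [rho >= 1]. *)
have HC k l : `|H k l| <= C * rho ^+ k.
  rewrite /H /ltoeplitz_of; case: ifP => [lk|_]; last first.
    by rewrite normr0 mulr_ge0 ?exprn_ge0.
  apply: le_trans (hC _) _; apply: ler_wpM2l => //.
  by apply: ler_weXn2l; [exact: ltW|exact: leq_subr].
apply: normed_cvg.
apply: (@series_le_cvg _ _ (geometric (C ^+ 2 * beta) (rho ^+ 2 * beta))).
- by move=> n; exact: normr_ge0.
- move=> n; rewrite /geometric /= mulr_ge0 ?exprn_ge0 //.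
    by rewrite mulr_ge0 ?exprn_ge0 // ltW.
  by rewrite mulr_ge0 ?exprn_ge0 // ltW.
- move=> n; rewrite /filter_term /geometric /= !normrM.
  have -> : C ^+ 2 * beta * (rho ^+ 2 * beta) ^+ n =
      C * rho ^+ n * (C * rho ^+ n) * beta ^+ n.+1.
    by rewrite exprMn [beta ^+ n.+1]exprS exprAC; ring.
  rewrite [`|beta ^+ _|]ger0_norm ?exprn_ge0 ?(ltW beta_gt0) //.
  by rewrite ler_wpM2r ?exprn_ge0 ?(ltW beta_gt0) // ler_pM.
- apply: is_cvg_geometric_series; rewrite ger0_norm //.
  by rewrite mulr_ge0 ?exprn_ge0 // ltW.
Qed.

Lemma filter_gramC i j : filter_gram i j = filter_gram j i.
Proof.
rewrite /filter_gram; congr (limn (series _)); apply/funext => k.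
by rewrite /filter_term [H k i * _]mulrC.
Qed.

(** The term [k = 0] vanishes, as row 0 of [H] is zero in column [i.+1]; each later term is [beta]
    times its predecessor in the series for [i], [j]. *)
Lemma filter_gramS i j : filter_gram i.+1 j.+1 = beta * filter_gram i j.
Proof.
have shiftE n : series (filter_term i.+1 j.+1) n.+1 =
    beta * series (filter_term i j) n.
  rewrite /series /= big_nat_recl // {1}/filter_term /H {1}/ltoeplitz_of /= !mul0r.
  rewrite add0r mulr_sumr; apply: eq_bigr => k _.
  by rewrite /filter_term /H /ltoeplitz_of !ltnS !subSS [beta ^+ k.+2]exprS; ring.
apply/cvg_lim => //; rewrite -cvg_shiftS.
under eq_fun do rewrite shiftE.
by apply: cvgMr; exact: filter_term_cvg.
Qed.

Lemma filter_gram_shift k i j :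
  filter_gram (i + k)%N (j + k)%N = beta ^+ k * filter_gram i j.
Proof.
elim: k => [|k IH]; first by rewrite !addn0 mul1r.
by rewrite !addnS filter_gramS IH exprS mulrA.
Qed.

Lemma filter_gram_posdef n (f : 'I_n -> nat) : h 0%N != 0 ->
  {homo f : i j / (i < j)%N} -> forall y : 'I_n -> R, (exists i, y i != 0) ->
  0 < \sum_i \sum_j y i * filter_gram (f i) (f j) * y j.
Proof.
move=> h0 fmono y [i1 yi1].
pose q k := (\sum_i y i * H k (f i)) ^+ 2 * beta ^+ k.+1.
have q0 k : 0 <= q k by rewrite /q mulr_ge0 ?sqr_ge0 ?exprn_ge0 // ltW.
have qcvg : series q @ \oo -->
    \sum_i \sum_j y i * filter_gram (f i) (f j) * y j.
  (* Expanding the squares and exchanging finite sums turns partial sums of [q] into quadratic forms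
     of the truncated series. *)
  have -> : series q =
      fun m => \sum_i \sum_j y i * series (filter_term (f i) (f j)) m * y j.
    apply/funext => m; rewrite /series /=.
    under [RHS]eq_bigr => i _ do under eq_bigr => j _
      do rewrite mulr_sumr mulr_suml.
    under [RHS]eq_bigr => i _ do rewrite exchange_big /=.
    rewrite [RHS]exchange_big /=; apply: eq_bigr => k _.
    rewrite /q expr2 mulr_suml mulr_suml; apply: eq_bigr => i _.
    rewrite mulr_sumr mulr_suml; apply: eq_bigr => j _.
    by rewrite /filter_term; ring.
  do 2!(apply: cvg_big => [|? _]; first exact: add_continuous).
  apply: cvgMl; apply: cvgMr; exact: filter_term_cvg.
(* At [k = f i0] with [i0] the first index of the support of [y], only the
   [i0] term of the inner sum survives. *)
have [i0 yi0 i0min] := @arg_minnP _ i1 (fun i => y i != 0) (fun i => i : nat) yi1.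
have qi0 : 0 < q (f i0).
  rewrite /q pmulr_lgt0 ?[0 < beta ^+ _]exprn_gt0 // exprn_even_gt0 //=.
  rewrite (bigD1 i0) //= big1 ?addr0 => [|i ii0].
    by rewrite /H /ltoeplitz_of leqnn subnn mulf_neq0.
  have [->|yi] := eqVneq (y i) 0; first by rewrite mul0r.
  have /fmono fi : (i0 < i)%N.
    by rewrite ltn_neqAle i0min // andbT eq_sym.
  by rewrite /H /ltoeplitz_of leqNgt fi mulr0.
(* The limit dominates the partial sum whose last term is the positive [q (f i0)]. *)
have nd : nondecreasing_seq (series q).
  by apply/nondecreasing_series => k _ _; exact: q0.
rewrite -(cvg_lim _ qcvg) //.
apply: lt_le_trans (nondecreasing_cvgn_le nd (cvgP _ qcvg) (f i0).+1).
rewrite /series /= big_nat_recr //=.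
by apply: ltr_wpDl => //; apply: sumr_ge0 => k _; exact: q0.
Qed.

(** The factor [beta ^ ((t + s) / 2)] splits as [s i * s j], so dividing by it is a congruence by a
    positive diagonal matrix: the form at [x] is the old one at [x i / s (f i)]. *)
Lemma filter_gram_ecls (kappa : R) : 0 < kappa -> h 0%N != 0 ->
  ecls beta (fun i j => kappa * filter_gram i j).
Proof.
move=> kappa0 h0.
pose s i := beta `^ (i.+1%:R / 2).
have s0 i : s i != 0 by rewrite gt_eqF // powR_gt0.
have bD x z : beta `^ (x + z) = beta `^ x * beta `^ z.
  by rewrite powRD // (gt_eqF beta_gt0) implybT.
have sE i j : beta `^ ((i.+1 + j.+1)%:R / 2) = s i * s j.
  by rewrite natrD mulrDl bD.
have sS k i j : s (i + k)%N * s (j + k)%N = beta ^+ k * (s i * s j).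
  rewrite -!sE -powR_mulrn ?(ltW beta_gt0) // -bD; congr (_ `^ _).
  by rewrite -![(_ + k).+1]addSn !natrD; field.
exists (fun i j => kappa * (filter_gram i j / (s i * s j))); last first.
  by move=> i j; rewrite sE mulrCA [s i * s j * _]mulrC divfK ?mulf_neq0.
split; last first.
  move=> k i j /=; rewrite filter_gram_shift sS -mulf_div divff ?mul1r //.
  by rewrite expf_neq0 ?gt_eqF.
split=> [i j|n f fmono x x0]; first by rewrite filter_gramC [s i * _]mulrC.
rewrite mxE.
have -> : \sum_j (x^T *m principal_submx
      (fun i j => kappa * (filter_gram i j / (s i * s j))) f) 0 j * x j 0 =
    kappa * \sum_i \sum_j
      (x i 0 / s (f i)) * filter_gram (f i) (f j) * (x j 0 / s (f j)).
  rewrite exchange_big mulr_sumr; apply: eq_bigr => j _ /=.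
  rewrite mxE mulr_suml mulr_sumr; apply: eq_bigr => i _.
  by rewrite !mxE; field; rewrite !s0.
apply: mulr_gt0 => //; apply: filter_gram_posdef => //.
have /cV0Pn[i xi] := x0.
by exists i; rewrite mulf_neq0 ?invr_eq0.
Qed.

End FilterKernel.

Lemma filter_kernel_ecls (R : realType) (beta rho kappa : R) (c : nat -> R) :
  0 < beta -> 1 < rho -> rho ^+ 2 * beta < 1 -> 0 < kappa ->
  conv_inv_growth rho c ->
  filter_kernel_cvg beta (ltoeplitz_of c) /\
  ecls beta (filter_kernel kappa beta (ltoeplitz_of c)).
Proof.
move=> beta0 rho1 rb kappa0 [h ch hg].
have ch0 : c 0%N * h 0%N = 1.
  by have := congr1 (@^~ 0%N) ch; rewrite /cauchy_conv big_ord1.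
have [c0 h0] : c 0%N != 0 /\ h 0%N != 0.
  by apply/andP; rewrite -negb_or -mulf_eq0 ch0 oner_eq0.
(* Uniqueness of the Toeplitz inverse identifies the chosen one with [h]; commutativity makes [h]
   two-sided. *)
have invE : ltoeplitz_inv (ltoeplitz_of c) = ltoeplitz_of h.
  apply/esym/ltoeplitz_invP; [exact: lt_toeplitz_of|by []|].
  split; first exact: lt_toeplitz_of.
    by rewrite infmx_mul_ltoeplitz_of ch ltoeplitz_one.
  by rewrite infmx_mul_ltoeplitz_of Defs.convC ch ltoeplitz_one.
have termE i j : (fun k => infmx_mul (infmx_tr (ltoeplitz_of h)) (Dinvmx beta) i k
    * ltoeplitz_of h k j) = filter_term beta h i j.
  by apply/funext => k; exact: filter_product_term.
split=> [i j|].
  by rewrite invE termE; exact: (filter_term_cvg beta0 rho1 rb hg).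
have -> : filter_kernel kappa beta (ltoeplitz_of c) =
    fun i j => kappa * filter_gram beta h i j.
  apply/funext => i; apply/funext => j.
  by rewrite /filter_kernel invE /infmx_mul termE.
exact: (filter_gram_ecls beta0 rho1 rb hg).
Qed.

Unset Implicit Arguments.
Set Strict Implicit.

Theorem theorem8p1 (R : realType) (alpha beta kappa_TC kappa_DC : R)
    (delta : nat)
    (hbeta : 0 < beta < 1) (halpha : 0 <= alpha <= 1) (hdelta : (2 < delta)%N)
    (hTC : 0 < kappa_TC) (hDC : 0 < kappa_DC) :
  (filter_kernel_cvg beta (infmx_exp (Fmx R) delta) /\
   ecls beta (TC_kernel kappa_TC beta delta)) /\
  (filter_kernel_cvg beta (Fmx_mix delta alpha) /\
   ecls beta (DC_kernel kappa_DC alpha beta delta)).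
Proof.
have /andP[beta0 beta1] := hbeta.
(* A rational choice strictly between 1 and [beta ^ (-1/2)]: the inverse of the arithmetic mean of 1
   and [beta]. *)
pose rho := 2 / (1 + beta).
have rho1 : 1 < rho by rewrite /rho ltr_pdivlMr; lra.
have rb : rho ^+ 2 * beta < 1.
  rewrite /rho expr_div_n mulrAC ltr_pdivrMr ?exprn_gt0 ?addr_gt0 //.
  (* [(1 + beta) ^+ 2 - 4 * beta = (1 - beta) ^+ 2] *)
  have : 0 < (1 - beta) ^+ 2 by rewrite exprn_gt0 // subr_gt0.
  nra.
split.
  have [c ec cg] := infmx_exp_F_growth delta rho1.
  by rewrite /TC_kernel ec; exact: filter_kernel_ecls cg.
case: delta hdelta => // n _.
have [c ec cg] := Fmx_mix_growth n rho1 halpha.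
by rewrite /DC_kernel ec; exact: filter_kernel_ecls cg.
Qed.
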